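(* Let $\mathcal{U}\neq\{\Omega_n,\emptyset\}$ be a family of subsets of $\Omega_n=\{1,\dots,n\}$ closed under pairwise union and containing $\Omega_n$ and $\emptyset$, and suppose $\mathcal{U}$ is canonical (as defined in the context). Write $\mathcal{U}=\{A_1,A_2,\dots,A_k,\emptyset\}$ with $A_1<A_2<\dots<A_k$ the non-empty members, and let $1\le m\le k$. Then $\{A_1,A_2,\dots,A_m,\emptyset\}$ is also canonical.
   Context: For $A\subseteq\Omega_n$ let $b(A)=\sum_{i\in A}2^{i-1}$. Subsets of $\Omega_n$ are totally ordered by: $A>B$ if $|A|<|B|$, or $|A|=|B|$ and $b(A)>b(B)$ (so $\emptyset$ is the largest set and sets with more elements are smaller). For a family $\mathcal{U}$ of subsets of $\Omega_n$ containing $\emptyset$ whose non-empty members are $A_1<\dots<A_k$, define the string $s(\mathcal{U})=(b(A_1),\dots,b(A_k))$. For a permutation $\Pi$ of $\Omega_n$, $\Pi(\mathcal{U})=\{\Pi(A):A\in\mathcal{U}\}$. The family $\mathcal{U}$ is called canonical (the canonical representative of its isomorphism class) if $s(\mathcal{U})$ is lexicographically smallest among all strings $s(\Pi(\mathcal{U}))$, $\Pi$ ranging over all permutations of $\Omega_n$. *)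

(* Defs.v *)
From mathcomp Require Import all_boot all_order fingroup perm.

Set Implicit Arguments.
Unset Strict Implicit.
Unset Printing Implicit Defensive.

(* The ground set {1, ..., n} is encoded as 'I_n = {0, ..., n-1}: the ordinal
   i stands for the element i + 1, hence the weight 2 ^ i below. *)
Definition bin_code (n : nat) (A : {set 'I_n}) : nat := \sum_(i in A) 2 ^ i.

(* Sets with more elements are smaller; ties are broken by bin_code. *)
Definition set_lt (n : nat) : rel {set 'I_n} := fun A B =>
  (#|B| < #|A|) || ((#|A| == #|B|) && (bin_code A < bin_code B)).

Definition set_le (n : nat) : rel {set 'I_n} := fun A B =>
  (A == B) || set_lt A B.

Definition fam_string (n : nat) (U : {set {set 'I_n}}) : seq nat :=
  [seq bin_code A | A <- sort (@set_le n) (enum (U :\ set0))].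

Definition perm_fam (n : nat) (p : {perm 'I_n}) (U : {set {set 'I_n}}) :
    {set {set 'I_n}} :=
  [set [set p i | i in A] | A : {set 'I_n} in U].

Definition canonical (n : nat) (U : {set {set 'I_n}}) : Prop :=
  forall p : {perm 'I_n},
    (fam_string U <= fam_string (perm_fam p U) :> seqlexi nat)%O.

Definition union_closed (n : nat) (U : {set {set 'I_n}}) : Prop :=
  forall A B : {set 'I_n}, A \in U -> B \in U -> A :|: B \in U.

(* Main.v *)
(* A permutation preserves cardinalities, so the i-th sets of the sorted
   families U, p(U), V = {A_1, ..., A_m} and p(V) all have the same cardinality
   for i <= m.  Since p(V) is a subfamily of p(U), the i-th set of p(U) is at
   most the i-th set of p(V), and as the cardinalities agree this is an
   inequality between binary codes.  Hence s(V), which is the prefix of length m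
   of s(U), is at most the prefix of length m of s(p(U)), which is pointwise at
   most s(p(V)). *)
Require Import Defs.
From mathcomp Require Import all_boot all_order fingroup perm.

Set Implicit Arguments.
Unset Strict Implicit.
Unset Printing Implicit Defensive.

Import Order.TTheory.

(** Dropping entries from [t] only shifts the survivors towards the front, so position [i] of [s]
    holds an entry that stood at position [i] or later in [t]. *)
Lemma subseq_sorted_nth (T : eqType) (leT : rel T) (x0 : T) (s t : seq T) i :
  reflexive leT -> transitive leT -> sorted leT t -> subseq s t ->
  i < size s -> leT (nth x0 t i) (nth x0 s i).
Proof.
move=> leT_refl leT_tr; elim: t s i => [|y t IHt] [|x s] //= i tS.
have tS' := path_sorted tS.
case: eqP => [-> | _] st; first by case: i => //= i; apply: IHt.
(* Here the head [y] is dropped: induction compares the entry of [x :: s] with entry [i] of [t],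
   which is the immediate successor of entry [i] of [y :: t]. *)
move=> lt_i; apply: leT_tr (IHt _ i tS' st lt_i).
have lt_it : i < size t by apply: leq_trans (size_subseq st).
by move/(pathP x0)/(_ i lt_it): tS.
Qed.

(** Truncation either keeps the place where the strings first part or makes them equal. *)
Lemma lexi_take d (T : orderType d) m (s t : seqlexi T) :
  (s <= t)%O -> (take m s <= take m t :> seqlexi T)%O.
Proof.
elim: m s t => [|m IHm] [|x s] [|y t] //=.
by rewrite !lexi_cons => /andP[-> /implyP st]; apply/implyP => /st/IHm.
Qed.

Lemma lexi_nth d (T : orderType d) (x0 : T) (s t : seqlexi T) :
  size s = size t -> (forall i, i < size s -> nth x0 s i <= nth x0 t i)%O ->
  (s <= t)%O.
Proof.
elim: s t => [|x s IHs] [|y t] //= [st] le_st.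
rewrite lexi_cons (le_st 0) //=; apply/implyP => _.
by apply: IHs => // i; apply: (le_st i.+1).
Qed.

(** Uniqueness of binary expansions: the parity of the sum gives bit 0, and cancelling it and
    halving leaves the same problem for the shifted bits. *)
Lemma sum_bits_inj n (f g : 'I_n -> bool) :
  \sum_(i < n) f i * 2 ^ i = \sum_(i < n) g i * 2 ^ i -> f =1 g.
Proof.
have split_low m (h : 'I_m.+1 -> bool) :
    \sum_(i < m.+1) h i * 2 ^ i
      = h ord0 + (\sum_(i < m) h (lift ord0 i) * 2 ^ i).*2.
  rewrite big_ord_recl muln1 -muln2 big_distrl /=; congr (_ + _).
  by apply: eq_bigr => i _; rewrite expnSr mulnA.
elim: n f g => [|n IHn] f g; first by move=> _ [].
rewrite !split_low => fg.
have fg0 : f ord0 = g ord0.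
  by have /(congr1 odd) := fg; rewrite !oddD !odd_double !addbF !oddb.
have fgS := IHn (f \o lift ord0) (g \o lift ord0).
move: fg; rewrite fg0 => /addnI/double_inj/fgS fg i.
by case: (unliftP ord0 i) => [j ->|->] //; apply: fg.
Qed.

Section SetOrder.
Variable n : nat.
Implicit Types (A B C : {set 'I_n}) (U V : {set {set 'I_n}})
  (s : seq {set 'I_n}) (p : {perm 'I_n}).

Lemma bin_code_inj : injective (@bin_code n).
Proof.
have bin_codeE A : bin_code A = \sum_(i < n) (i \in A) * 2 ^ i.
  by rewrite /bin_code big_mkcond; apply: eq_bigr => i _; case: (i \in A); rewrite ?mul1n.
by move=> A B; rewrite !bin_codeE => /sum_bits_inj AB; apply/setP.
Qed.

(** Injectivity of [bin_code] absorbs the case [A == B] into a non-strict comparison of codes. *)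
Lemma set_leE A B :
  set_le A B = (#|B| < #|A|) || (#|A| == #|B|) && (bin_code A <= bin_code B).
Proof.
rewrite /set_le /set_lt (leq_eqVlt (bin_code A)) (inj_eq bin_code_inj).
by have [->|_] := eqVneq A B; rewrite ?eqxx ?orbT.
Qed.

Lemma set_le_refl : reflexive (@set_le n).
Proof. by move=> A; rewrite /set_le eqxx. Qed.

Lemma set_le_trans : transitive (@set_le n).
Proof.
move=> B A C; rewrite !set_leE.
case/orP => [BA | /andP[/eqP-> AB]] /orP[CB | /andP[/eqP BC BC']].
- by rewrite (ltn_trans CB BA).
- by rewrite -BC BA.
- by rewrite CB.
- by rewrite BC eqxx (leq_trans AB BC') orbT.
Qed.

Lemma set_le_total : total (@set_le n).
Proof. by move=> A B; rewrite !set_leE; case: ltngtP => //= _; apply: leq_total. Qed.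

Lemma set_le_anti : antisymmetric (@set_le n).
Proof.
move=> A B; rewrite !set_leE; case: ltngtP => //= _ AB.
by apply/bin_code_inj/eqP; rewrite eqn_leq.
Qed.

Lemma set_lt_trans : transitive (@set_lt n).
Proof.
move=> B A C; rewrite /set_lt.
case/orP => [BA | /andP[/eqP-> AB]] /orP[CB | /andP[/eqP BC BC']].
- by rewrite (ltn_trans CB BA).
- by rewrite -BC BA.
- by rewrite CB.
- by rewrite BC eqxx (ltn_trans AB BC') orbT.
Qed.

Lemma set_lt_irr : irreflexive (@set_lt n).
Proof. by move=> A; rewrite /set_lt !ltnn andbF. Qed.

(** Keeps the sets where [fam_string] records only codes, since cardinalities must be compared
    before codes. *)
Definition sorted_members U : seq {set 'I_n} :=
  sort (@set_le n) (enum (U :\ set0)).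

Lemma sorted_membersP U : sorted (@set_le n) (sorted_members U).
Proof. exact: sort_sorted set_le_total _. Qed.

(** Sorting by a total transitive relation commutes with filtering, and the members of [V] are
    obtained by filtering those of [U]. *)
Lemma sorted_members_subseq U V :
  V \subset U -> subseq (sorted_members V) (sorted_members U).
Proof.
move=> VU; rewrite /sorted_members.
suff -> : enum (V :\ set0) = filter (mem V) (enum (U :\ set0)).
  rewrite -(filter_sort set_le_total set_le_trans); exact: filter_subseq.
rewrite {1}/enum_mem -filter_predI; apply: eq_filter => A /=.
rewrite !inE; case: (boolP (A \in V)) => [/(subsetP VU)-> | _]; last by rewrite andbF.
by rewrite andbT.
Qed.

(** Only a permutation of the image list can be expected, as [p] may reorder sets of equal size. *)
Lemma sorted_members_perm_fam p s :
  sorted (@set_lt n) s -> set0 \notin s ->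
  perm_eq (sorted_members (perm_fam p (set0 |: [set B in s])))
          [seq [set p i | i in B] | B : {set 'I_n} <- s].
Proof.
move=> s_sorted s_n0; rewrite perm_sort.
have im_inj : injective (fun B : {set 'I_n} => [set p i | i in B]).
  exact: imset_inj (@perm_inj _ p).
apply: uniq_perm; first exact: enum_uniq.
  by rewrite map_inj_uniq //; apply: sorted_uniq set_lt_trans set_lt_irr _ s_sorted.
move=> B; rewrite mem_enum !inE; apply/andP/mapP.
  case=> B_n0 /imsetP[C]; rewrite !inE => /orP[/eqP-> BC | Cs ->]; last by exists C.
  by rewrite BC imset0 eqxx in B_n0.
case=> C Cs ->; split; last by apply: imset_f; rewrite !inE Cs orbT.
by rewrite imset_eq0; apply: contraNneq s_n0 => <-.
Qed.

Lemma sorted_members_of_seq s :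
  sorted (@set_lt n) s -> set0 \notin s ->
  sorted_members (set0 |: [set B in s]) = s.
Proof.
move=> s_sorted s_n0; apply: (sorted_eq set_le_trans set_le_anti).
- exact: sorted_membersP.
- by apply: sub_sorted s_sorted => A B; rewrite /set_le => ->; rewrite orbT.
rewrite perm_sort; apply: uniq_perm; first exact: enum_uniq.
  exact: sorted_uniq set_lt_trans set_lt_irr _ s_sorted.
move=> B; rewrite mem_enum !inE.
by have [->|] := eqVneq B set0; rewrite // (negPf s_n0).
Qed.

Lemma sorted_set_le_cards s :
  sorted (@set_le n) s -> sorted geq [seq #|B| | B : {set 'I_n} <- s].
Proof.
rewrite sorted_map; apply: sub_sorted => A B /=; rewrite set_leE.
by case/orP => [/ltnW | /andP[/eqP-> _]].
Qed.

(** Both lists of cardinalities are non-increasing and, [p] being injective, they have the same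
    entries with multiplicity; hence they coincide even where [p] reorders sets. *)
Lemma sorted_members_perm_fam_cards p s :
  sorted (@set_lt n) s -> set0 \notin s ->
  [seq #|B| | B : {set 'I_n} <- sorted_members (perm_fam p (set0 |: [set B in s]))]
    = [seq #|B| | B : {set 'I_n} <- s].
Proof.
move=> s_sorted s_n0; apply: (@sorted_eq _ geq).
- by move=> a b c /= ab ca; apply: leq_trans ca ab.
- by move=> a b /= /andP[ab ba]; apply/eqP; rewrite eqn_leq ab ba.
- exact/sorted_set_le_cards/sorted_membersP.
- rewrite -{1}(sorted_members_of_seq s_sorted s_n0).
  exact/sorted_set_le_cards/sorted_membersP.
rewrite (permPl (perm_map _ (sorted_members_perm_fam p s_sorted s_n0))).
by rewrite -map_comp (eq_map (g := fun B : {set 'I_n} => #|B|)) // => B /=; apply/card_imset/perm_inj.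
Qed.

End SetOrder.

Theorem theorem1 (n : nat) (U : {set {set 'I_n}})
    (U_neq : U <> [set [set: 'I_n]; set0])
    (U_union : union_closed U)
    (U_full : [set: 'I_n] \in U)
    (U_empty : set0 \in U)
    (U_canonical : canonical U)
    (k : nat) (A : k.-tuple {set 'I_n})
    (A_sorted : sorted (@set_lt n) A)
    (A_nonempty : set0 \notin A)
    (U_eq : U = set0 |: [set B in A])
    (m : nat) (m_ge1 : 1 <= m) (m_le_k : m <= k) :
  canonical (set0 |: [set B in take m A]).
Proof.
move=> p; set V := set0 |: _.
have takeA_sorted := take_sorted m A_sorted.
have takeA_n0 : set0 \notin take m A by apply: contra A_nonempty; apply: mem_take.
have size_takeA : size (take m A) = m by rewrite size_takel ?size_tuple.
have VU : perm_fam p V \subset perm_fam p U.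
  apply: imsetS; rewrite U_eq; apply/setUS/subsetP => B.
  by rewrite !inE; apply: mem_take.
have cardsU := sorted_members_perm_fam_cards p A_sorted A_nonempty.
have cardsV := sorted_members_perm_fam_cards p takeA_sorted takeA_n0.
rewrite -U_eq in cardsU; rewrite -/V in cardsV.
set sU := sorted_members (perm_fam p U) in cardsU.
set sV := sorted_members (perm_fam p V) in cardsV.
have size_sU : size sU = k by have := congr1 size cardsU; rewrite !size_map size_tuple.
have size_sV : size sV = m by have := congr1 size cardsV; rewrite !size_map size_takeA.
(* [A] and [take m A] are already the sorted lists of non-empty members of [U] and [V]. *)
have fam_V : fam_string V = take m (fam_string U).
  rewrite /fam_string -!/(sorted_members _) U_eq !sorted_members_of_seq //.
  exact: map_take.
rewrite fam_V; apply: le_trans (lexi_take m (U_canonical p)) _.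
rewrite /fam_string -!/(sorted_members _) -/sU -/sV -map_take.
apply: (lexi_nth (x0 := 0)) => [|i].
  by rewrite !size_map size_takel ?size_sU.
rewrite size_map size_takel ?size_sU // => lt_im.
have lt_iV : i < size sV by rewrite size_sV.
have lt_iU : i < size sU by rewrite size_sU (leq_trans lt_im).
rewrite !(nth_map set0) ?size_takel ?size_sU // nth_take //.
(* Both sides equal the cardinality of entry [i] of [A], which [take m] keeps because [i < m]. *)
have card_eq : #|nth set0 sU i| = #|nth set0 sV i|.
  rewrite -(nth_map set0 0 (fun B : {set 'I_n} => #|B|)) // cardsU.
  rewrite -(nth_map set0 0 (fun B : {set 'I_n} => #|B|) lt_iV) cardsV.
  by rewrite map_take nth_take.
(* With the cardinalities equal, [set_le] between these entries reduces to the required inequality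
   of codes. *)
have := subseq_sorted_nth set0 (@set_le_refl n) (@set_le_trans n)
  (sorted_membersP _) (sorted_members_subseq VU) lt_iV.
by rewrite set_leE card_eq ltnn eqxx.
Qed.
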